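(* Consider a two-node cycle with real nonzero true parameters $a_{12}^0,a_{21}^0$, which is stable (i.e. $|a_{12}^0a_{21}^0|<1$) and uniformly excited ($\sigma_1^2=\sigma_2^2=\sigma^2>0$ and $\lambda_1=\lambda_2=\lambda>0$). Let $P^{\mathrm{I}},P^{\mathrm{II}},P^{\mathrm{III}},P^{\mathrm{IV}}$ be the asymptotic covariance matrices of the estimates of $(a_{12},a_{21})$ under the four excitation and measurement patterns (I) $\mathcal B=\{1,2\},\ \mathcal C=\{1\}$; (II) $\mathcal B=\{1,2\},\ \mathcal C=\{2\}$; (III) $\mathcal B=\{1\},\ \mathcal C=\{1,2\}$; (IV) $\mathcal B=\{2\},\ \mathcal C=\{1,2\}$. Then: 1. $P^{\mathrm{I}}=P^{\mathrm{IV}}$ and $P^{\mathrm{II}}=P^{\mathrm{III}}$; 2. if $|a_{21}^0|>|a_{12}^0|$ then $\mathrm{tr}(P^{\mathrm{I}})>\mathrm{tr}(P^{\mathrm{II}})$; 3. if $|a_{21}^0|<|a_{12}^0|$ then $\mathrm{tr}(P^{\mathrm{I}})<\mathrm{tr}(P^{\mathrm{II}})$.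
   Context: A dynamic network with $n$ nodes is $w(t)=G^0(q)w(t)+Br(t)$, $y(t)=Cw(t)+e(t)$, $t\in\mathbb Z$, where $q$ is the forward shift operator ($qr(t)=r(t+1)$), $w(t)\in\mathbb R^n$ are the node signals, $r$ the external excitations, $y$ the measured outputs, $e$ the measurement noise. $B$ and $C$ are binary selection matrices; $\mathcal B$ is the set of nodes $i$ to which an external signal $r_i$ is applied, and $\mathcal C$ is the set of nodes $j$ that are measured, $y_j=w_j+e_j$. The pair $(\mathcal B,\mathcal C)$ is called an excitation and measurement pattern (EMP). The two-node cycle has $G^0(q)=q^{-1}\begin{bmatrix}0&a_{12}^0\\ a_{21}^0&0\end{bmatrix}$ with real nonzero $a_{12}^0,a_{21}^0$, i.e. $w_1(t)=a_{12}^0w_2(t-1)+r_1(t)$, $w_2(t)=a_{21}^0w_1(t-1)+r_2(t)$, with $r_i\equiv 0$ if $i\notin\mathcal B$; signals are the stationary solutions. Assumptions: the network is stable; the $r_i$, $i\in\mathcal B$, are mutually independent stationary zero-mean white noise processes with variances $\sigma_i^2>0$, uncorrelated with the noises; the $e_j$, $j\in\mathcal C$, are independent stationary Gaussian zero-mean white noise processes with variances $\lambda_j>0$. For a parameter vector $\theta=(a_{12},a_{21})$, let $G(q,\theta)$ be the network matrix with $a_{ij}$ in place of $a_{ij}^0$. The optimal one-step-ahead predictor is $\hat y(t|t-1;\theta)=C(I-G(q,\theta))^{-1}Br(t)$. Let $\psi(t)$ be the $2\times|\mathcal C|$ matrix whose entry in the row of parameter $\theta_k$ and column of output $j\in\mathcal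 C$ is $\partial \hat y_j(t|t-1;\theta)/\partial\theta_k$ evaluated at the true parameter, and $\Lambda=\mathrm{diag}(\lambda_j)_{j\in\mathcal C}$. The asymptotic covariance matrix of the EMP is $P=[\mathbb E\,\psi(t)\Lambda^{-1}\psi(t)^T]^{-1}$. *)

(* Defs.v *)
From HB Require Import structures.
From mathcomp Require Import all_boot all_order all_algebra.
From mathcomp Require Import all_classical all_reals all_analysis.

Set Implicit Arguments.
Unset Strict Implicit.
Unset Printing Implicit Defensive.

Import Order.TTheory GRing.Theory Num.Theory.
Import numFieldNormedType.Exports.

Local Open Scope classical_set_scope.
Local Open Scope ring_scope.

(** * Processes indexed by discrete time *)

Section Processes.
Context (R : realType) (d : measure_display) (T : measurableType d).
Context (P : probability T R).

(* Wide-sense white noise: zero mean, constant variance [v], no correlation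
   between distinct times; wide-sense stationarity is part of the definition. *)
Definition white_noise (X : int -> {RV P >-> R}) (v : R) : Prop :=
  [/\ forall t, (X t : T -> R) \in Lfun P 2%:E,
      forall t, ('E_P[X t] = 0)%E &
      forall t s, covariance P (X t) (X s) = (if t == s then v else 0)%:E].

(* [normal_prob m 0] is not the Dirac mass in the library, hence the second
   disjunct for degenerate Gaussian laws. *)
Definition gaussian_law (f : T -> R) : Prop :=
  (exists m s : R, 0 < s /\
     forall A : set R, measurable A -> P (f @^-1` A) = normal_prob m s A) \/
  (exists m : R,
     forall A : set R, measurable A -> P (f @^-1` A) = \d_m A).

Definition gaussian_process (X : int -> {RV P >-> R}) : Prop :=
  forall (s : seq int) (c : int -> R),
    gaussian_law (fun omega => \sum_(t <- s) c t * X t omega).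

Definition process_sigma (X : int -> {RV P >-> R}) : set (set T) :=
  <<s [set A | exists t (U : set R), measurable U /\ A = X t @^-1` U] >>.

(* Taking some of the [A i] equal to [setT] gives the product rule for all
   subfamilies of [D]. *)
Definition independent_processes (n : nat) (D : {set 'I_n})
    (X : 'I_n -> int -> {RV P >-> R}) : Prop :=
  forall A : 'I_n -> set T,
    (forall i, i \in D -> process_sigma (X i) (A i)) ->
    P (\big[setI/setT]_(i in D) A i) = (\prod_(i in D) P (A i))%E.

End Processes.

(** * Excitation and measurement patterns *)

(* An experiment carried out with the pattern [(B, C)]. Only the excitations
   [exc i] with [i \in B] and the noises [noise j] with [j \in C] are
   constrained, and only these are used below. *)
Record experiment (R : realType) (n : nat) (B C : {set 'I_n})
    (sigma2 lambda : 'I_n -> R) := Experiment {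
  exp_disp : measure_display;
  exp_space : measurableType exp_disp;
  exp_prob : probability exp_space R;
  exc : 'I_n -> int -> {RV exp_prob >-> R};
  noise : 'I_n -> int -> {RV exp_prob >-> R};
  exc_white : forall i, i \in B -> white_noise (exc i) (sigma2 i);
  exc_indep : independent_processes B exc;
  noise_white : forall j, j \in C -> white_noise (noise j) (lambda j);
  noise_gauss : forall j, j \in C -> gaussian_process (noise j);
  noise_indep : independent_processes C noise;
  exc_noise_uncorr : forall i j t s, i \in B -> j \in C ->
    covariance exp_prob (exc i t) (noise j s) = 0%E
}.

Section Selection.
Context (R : realType) (n : nat).

(* r(t) lists the excitations of the nodes of B in the order of [enum B];
   likewise y(t) and Lambda for the nodes of C. *)
Definition excitation_mx (B : {set 'I_n}) : 'M[R]_(n, #|B|) :=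
  \matrix_(i, k) (i == enum_val k)%:R.

Definition measurement_mx (C : {set 'I_n}) : 'M[R]_(#|C|, n) :=
  \matrix_(k, j) (j == enum_val k)%:R.

Definition noise_cov_mx (C : {set 'I_n}) (lambda : 'I_n -> R) : 'M[R]_#|C| :=
  diag_mx (\row_k lambda (enum_val k)).

End Selection.

(** * Causal transfer matrices *)

(* A causal transfer matrix [sum_k H_k q^-k] is represented by its impulse
   response [k |-> H_k]. *)
Section Transfer.
Context (R : realType) (n : nat).

Definition transfer := nat -> 'M[R]_n.

Definition tf_one : transfer := fun k => if k == 0%N then 1%:M else 0.

Definition tf_sub (H K : transfer) : transfer := fun k => H k - K k.

Definition tf_mul (H K : transfer) : transfer :=
  fun k => \sum_(i < k.+1) H i *m K (k - i)%N.

(* The two-sided inverse, which is unique when it exists; 0 otherwise. *)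
Definition tf_inv (H : transfer) : transfer :=
  xget (fun=> 0) [set K | tf_mul H K = tf_one /\ tf_mul K H = tf_one].

Definition tf_apply (H : transfer) (u : int -> 'cV[R]_n) (t : int) : 'cV[R]_n :=
  \col_i limn (series (fun k : nat => (H k *m u (t - k%:Z)) i 0)).

End Transfer.

(** * The two-node cycle *)

Definition node1 : 'I_2 := ord0.
Definition node2 : 'I_2 := ord_max.

Section Cycle.
Context (R : realType).

(* The parameter vector (a12, a21). *)
Definition cycle_param (a12 a21 : R) : 'rV[R]_2 :=
  \row_k (if k == 0 then a12 else a21).

Definition cycle_mx (theta : 'rV[R]_2) : 'M[R]_2 :=
  \matrix_(i, j) (if (i == node1) && (j == node2) then theta 0 0
                  else if (i == node2) && (j == node1) then theta 0 1
                  else 0).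

(* G(q, theta) = q^-1 [[0, a12], [a21, 0]] *)
Definition cycle_tf (theta : 'rV[R]_2) : transfer R 2 :=
  fun k => if k == 1%N then cycle_mx theta else 0.

Section Covariance.
Context (B C : {set 'I_2}) (sigma2 lambda : 'I_2 -> R).
Variable E : experiment B C sigma2 lambda.

Definition excitation (t : int) (omega : exp_space E) : 'cV[R]_#|B| :=
  \col_k exc E (enum_val k) t omega.

Definition predictor (theta : 'rV[R]_2) (t : int) (omega : exp_space E) :
    'cV[R]_#|C| :=
  measurement_mx R C *m
  tf_apply (tf_inv (tf_sub (tf_one R 2) (cycle_tf theta)))
           (fun s => excitation_mx R B *m excitation s omega) t.

Definition sensitivity (theta0 : 'rV[R]_2) (t : int) (omega : exp_space E) :
    'M[R]_(2, #|C|) :=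
  \matrix_(k, j)
    'D_(delta_mx 0 k) (fun theta : 'rV[R]_2 => predictor theta t omega j 0)
      theta0.

Definition information_mx (theta0 : 'rV[R]_2) (t : int) : 'M[R]_2 :=
  \matrix_(k, l) fine ('E_(exp_prob E)[fun omega =>
    (sensitivity theta0 t omega *m invmx (noise_cov_mx C lambda)
       *m (sensitivity theta0 t omega)^T) k l])%E.

Definition asymptotic_cov (theta0 : 'rV[R]_2) (t : int) : 'M[R]_2 :=
  invmx (information_mx theta0 t).

End Covariance.

End Cycle.

(* Main.v *)
Require Import Defs.
From HB Require Import structures.
From mathcomp Require Import all_boot all_order all_algebra.
From mathcomp Require Import all_classical all_reals all_analysis.
From mathcomp Require Import measurable_realfun ring lra.

(** Write [z] for the loop gain [a12 a21], [theta_i] for the gain of the edge into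
    node [i] and [i'] for the other node. The predictor of the output of node [i]
    sums over the walks that end at [i]; those of even length bring the input of
    [i], those of odd length the input of [i'], so it equals
    [p(z) + theta_i q(z)] for two power series whose coefficients are delayed
    inputs ([cycle_mx_exp], [responseE]). Differentiating term by term, the
    sensitivity to a parameter is a series in the same delayed inputs
    ([derive_response]).

    Each excitation is white and two excitations are independent, so these inputs
    are uncorrelated and the mean of a product of two such series is the sum of
    the products of coefficients, weighted by the variances ([delayed_mean],
    [ae_has_mean_series]). Consequently the information matrix is a sum over the
    measured nodes [i]: the even walks contribute [same_node_info] if [i] is
    excited, and the odd walks contribute [other_node_info] at [i] if [i'] is
    excited ([information_mxE], [series_walk_sens]).

    Measuring [i] with both nodes excited collects both terms at [i]. Exciting [i']
    with both nodes measured collects the odd term at [i] and the even term at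
    [i'], and the even term does not depend on the node. The two information
    matrices are therefore equal, which gives the two equalities.

    The entries are sums of the series with terms [z^(2m)], [m z^(2m-1)] and
    [m^2 z^(2m-2)]. With [A = theta_i^2] and [B = theta_i'^2], the trace of
    the inverse is, up to a positive factor symmetric in [A] and [B],
    [(1 + A + B + A^2) / (A (1 + A B + A))] ([tr_inv_information]). Exchanging
    [A] and [B] gives the other pair of patterns, and for [A B < 1] the value is
    larger when [A < B] ([trace_ratio_lt]).

    All series in the inputs converge only almost surely, with a geometric rate
    ([ae_geo_bounded]), which is why means are taken up to null sets
    ([ae_has_mean]). *)

Set Implicit Arguments.
Unset Strict Implicit.
Unset Printing Implicit Defensive.

Import Order.TTheory GRing.Theory Num.Theory.
Import numFieldNormedType.Exports.

Local Open Scope classical_set_scope.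
Local Open Scope ring_scope.

(** * Geometrically bounded sequences and their series *)

Section GeometricBounds.
Context {R : realType}.
Implicit Types (r s z : R) (f g : R^nat).

(** A bound [O(r^n)]. It gives convergence when [r < 1], and a bound [O(r^-n)]
    on coefficients gives convergence of the power series inside the disc of
    radius [r]; products and interleavings only multiply or square the rates. *)
Definition geo_bounded r f :=
  exists2 D : R, 0 <= D & forall n, `|f n| <= D * r ^+ n.

Lemma geo_bounded_cvg r f : 0 <= r < 1 -> geo_bounded r f -> cvgn (series f).
Proof.
move=> /andP[r0 r1] [D D0 Df]; apply: normed_cvg.
apply: (@series_le_cvg _ _ (geometric D r)) => [n|n|n|] /=.
- exact: normr_ge0.
- by rewrite mulr_ge0 ?exprn_ge0.
- exact: Df.
- by apply: is_cvg_geometric_series; rewrite ger0_norm.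
Qed.

Lemma geo_bounded_le r s f : 0 <= r <= s -> geo_bounded r f -> geo_bounded s f.
Proof.
move=> /andP[r0 rs] [D D0 Df]; exists D => // n.
by rewrite (le_trans (Df n))// ler_wpM2l// lerXn2r// nnegrE (le_trans r0).
Qed.

Lemma geo_boundedD r f g :
  geo_bounded r f -> geo_bounded r g -> geo_bounded r (fun n => f n + g n).
Proof.
move=> [D D0 Df] [E E0 Eg]; exists (D + E); first exact: addr_ge0.
by move=> n; rewrite mulrDl (le_trans (ler_normD _ _))// lerD.
Qed.

Lemma geo_boundedM r s f g :
  geo_bounded r f -> geo_bounded s g -> geo_bounded (r * s) (fun n => f n * g n).
Proof.
move=> [D D0 Df] [E E0 Eg]; exists (D * E); first exact: mulr_ge0.
by move=> n; rewrite normrM exprMn mulrACA ler_pM.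
Qed.

Lemma geo_boundedZ r c f : geo_bounded r f -> geo_bounded r (fun n => c * f n).
Proof.
move=> [D D0 Df]; exists (`|c| * D); first exact: mulr_ge0.
by move=> n; rewrite normrM -mulrA ler_wpM2l.
Qed.

Lemma geo_bounded_pow r z : `|z| <= r -> geo_bounded r (GRing.exp z).
Proof.
move=> zr; exists 1; first exact: ler01.
by move=> n; rewrite mul1r normrX lerXn2r// nnegrE// (le_trans _ zr).
Qed.

(** By convexity [m |z|^(m-1)] is at most the slope of the chord of the [m]-th
    power between [|z|] and [r], and that slope is at most [r^m / (r - |z|)]. *)
Lemma geo_bounded_deriv r z : `|z| < r ->
  geo_bounded r (fun m => m%:R * z ^+ m.-1).
Proof.
move=> zr; have rz : 0 < r - `|z| by rewrite subr_gt0.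
exists (r - `|z|)^-1; first by rewrite invr_ge0 ltW.
have chord m : m.+1%:R * `|z| ^+ m * (r - `|z|) <= r ^+ m.+1.
  elim: m => [|m IHm]; first by rewrite expr0 !mulr1 expr1 mul1r gerBl.
  rewrite -[m.+2%:R]natr1 (_ : _ * _ = `|z| * (m.+1%:R * `|z| ^+ m * (r - `|z|))
    + `|z| ^+ m.+1 * (r - `|z|)); last by rewrite exprS; ring.
  rewrite [leRHS](_ : _ = `|z| * r ^+ m.+1 + r ^+ m.+1 * (r - `|z|)); last first.
    by rewrite [r ^+ m.+2]exprS; ring.
  rewrite lerD ?ler_wpM2l// ler_wpM2r ?(ltW rz)// lerXn2r ?nnegrE ?(ltW zr)//.
  by rewrite (le_trans _ (ltW zr)).
case=> [|m].
  rewrite mul0r normr0 mulr_ge0 ?exprn_ge0 ?invr_ge0 ?(ltW rz)//.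
  by rewrite (le_trans _ (ltW zr)).
by rewrite ler_pdivlMl// normrM normr_nat normrX mulrC.
Qed.

(** Sequences indexed by the length of a walk in the cycle split into walks of
    even length, which start where they end, and walks of odd length. *)
Definition interleave f g n := if odd n then g n./2 else f n./2.

Lemma geo_bounded_even r f : geo_bounded r f -> geo_bounded (r ^+ 2) (fun m => f m.*2).
Proof. by move=> [D D0 Df]; exists D => // m; rewrite -exprM mul2n. Qed.

Lemma geo_bounded_odd r f :
  0 <= r -> geo_bounded r f -> geo_bounded (r ^+ 2) (fun m => f m.*2.+1).
Proof.
move=> r0 [D D0 Df]; exists (D * r); first exact: mulr_ge0.
by move=> m; rewrite -exprM mul2n -mulrA -exprS.
Qed.

Lemma geo_bounded_interleave r f g : 0 < r ->
  geo_bounded (r ^+ 2) f -> geo_bounded (r ^+ 2) g -> geo_bounded r (interleave f g).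
Proof.
move=> r0 [D D0 Df] [E E0 Eg]; exists (D + E / r).
  by rewrite addr_ge0// mulr_ge0// invr_ge0 ltW.
move=> n; rewrite -{2}(odd_double_half n) /interleave; case: ifPn => _ /=.
  rewrite (le_trans (Eg _))// -exprM mul2n exprS mulrA ler_wpM2r ?exprn_ge0 ?(ltW r0)//.
  by rewrite mulrDl divfK ?gt_eqF// lerDr mulr_ge0// ltW.
rewrite (le_trans (Df _))// -exprM mul2n ler_wpM2r ?exprn_ge0 ?(ltW r0)//.
by rewrite lerDl mulr_ge0// invr_ge0 ltW.
Qed.

Lemma series_interleave f g n :
  series (interleave f g) n = series f (uphalf n) + series g n./2.
Proof.
elim: n => [|n IHn]; first by rewrite !seriesEnat /= !big_nil addr0.
rewrite seriesSr IHn /interleave /= !uphalf_half.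
by case: (odd n); rewrite ?add1n ?add0n !seriesSr; ring.
Qed.

Lemma cvg_half : (fun n => n./2) @ \oo --> \oo.
Proof.
move=> A [N _ NA]; exists N.*2 => // n /= Nn; apply: NA => /=.
by rewrite -(doubleK N) half_leq.
Qed.

Lemma cvg_series_interleave f g (l m : R) :
  series f @ \oo --> l -> series g @ \oo --> m ->
  series (interleave f g) @ \oo --> l + m.
Proof.
move=> fl gm; rewrite (_ : series _ = (series f \o uphalf) \+ (series g \o half)).
  apply: cvgD; last exact: (cvg_comp _ _ cvg_half gm).
  apply: (cvg_comp _ _ _ fl) => A /cvg_half[N _ NA].
  by exists N => // n /= Nn; apply: (NA n.+1); exact: leqW.
by apply/funext => n; rewrite series_interleave.
Qed.

(** Summing the recursion gives [L = f 0 + c L + l] for the sum [L] of [f]. *)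
Lemma cvg_series_recursion c f g (l : R) : c != 1 -> cvgn (series f) ->
  (forall n, f n.+1 = c * f n + g n) -> series g @ \oo --> l ->
  series f @ \oo --> (f 0%N + l) / (1 - c).
Proof.
move=> c1 /cvg_ex[/= L fL] fS gl.
have c1' : 1 - c != 0 by rewrite subr_eq0 eq_sym.
have -> // : (f 0%N + l) / (1 - c) = L.
have fL1 : series f \o S @ \oo --> L by have := fL; rewrite -(cvg_shiftS (series f)).
have fR : series f \o S @ \oo --> f 0%N + (c * L + l).
  rewrite (_ : _ \o _ = (fun n => f 0%N + (c * series f n + series g n))).
    by apply: cvgD; [exact: cvg_cst|apply: cvgD => //; apply: cvgM => //; exact: cvg_cst].
  apply/funext => n /=; rewrite seriesEnat/= big_nat_recl//=; congr (_ + _).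
  by rewrite !seriesEnat/= mulr_sumr -big_split; apply: eq_bigr => i _; rewrite fS.
have LE : L = f 0%N + (c * L + l) by exact: (cvg_unique _ fL1 fR).
by apply: (canLR (mulfK c1')); lra.
Qed.

Lemma cvg_series_pow z : `|z| < 1 -> series (GRing.exp z) @ \oo --> (1 - z)^-1.
Proof. by move=> z1; rewrite exprn_geometric -[_^-1]mul1r; apply: cvg_geometric_series. Qed.

Lemma cvg_series_deriv z : `|z| < 1 ->
  series (fun m => m%:R * z ^+ m.-1) @ \oo --> (1 - z)^-2.
Proof.
move=> z1; have [zr r1] := midf_lt z1.
have z1' : z != 1 by apply: contraTneq z1 => ->; rewrite normr1 ltxx.
have c : cvgn (series (fun m => m%:R * z ^+ m.-1)).
  apply: geo_bounded_cvg (geo_bounded_deriv zr); rewrite r1 andbT.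
  by rewrite (le_trans _ (ltW zr)).
have S n : n.+1%:R * z ^+ n.+1.-1 = z * (n%:R * z ^+ n.-1) + z ^+ n.
  by case: n => [|n]; rewrite ?mul0r ?mulr0 ?add0r ?mul1r//= -[n.+2%:R]natr1 exprS; ring.
have := cvg_series_recursion z1' c S (cvg_series_pow z1).
by rewrite mul0r add0r expr2 invfM.
Qed.

Lemma cvg_series_deriv_sqr z : `|z| < 1 ->
  series (fun m => (m%:R * z ^+ m.-1) ^+ 2) @ \oo --> (1 + z ^+ 2) / (1 - z ^+ 2) ^+ 3.
Proof.
move=> z1; have [zr r1] := midf_lt z1; set r := (_ / 2) in zr r1.
have r0 : 0 < r by rewrite (le_lt_trans _ zr).
have u1 : `|z ^+ 2| < 1 by rewrite normrX exprn_ilt1.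
have u1' : z ^+ 2 != 1 by apply: contraTneq u1 => ->; rewrite normr1 ltxx.
have c : cvgn (series (fun m => (m%:R * z ^+ m.-1) ^+ 2)).
  apply: (@geo_bounded_cvg (r * r)).
    by rewrite mulr_ge0 ?(ltW r0)//= mulr_ilt1// ltW.
  by under eq_fun do rewrite expr2; apply: geo_boundedM; exact: geo_bounded_deriv.
have S n : (n.+1%:R * z ^+ n.+1.-1) ^+ 2 = z ^+ 2 * (n%:R * z ^+ n.-1) ^+ 2 +
    (2 * z ^+ 2 * (n%:R * (z ^+ 2) ^+ n.-1) + (z ^+ 2) ^+ n).
  case: n => [|n]; first by rewrite !mul0r expr0n !mulr0 !add0r !expr0 !mul1r expr1n.
  have e : (z ^+ 2) ^+ n = (z ^+ n) ^+ 2 by rewrite -!exprM mulnC.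
  by rewrite /= -[n.+2%:R]natr1 [z ^+ n.+1]exprS [(z ^+ 2) ^+ n.+1]exprS e; ring.
pose l : R := 2 * z ^+ 2 * (1 - z ^+ 2) ^- 2 + (1 - z ^+ 2)^-1.
have -> : (1 + z ^+ 2) / (1 - z ^+ 2) ^+ 3 = ((0%:R * z ^+ 0.-1) ^+ 2 + l) / (1 - z ^+ 2).
  by rewrite /l; field; rewrite subr_eq0 eq_sym.
apply: (cvg_series_recursion u1' c S).
rewrite (_ : series _ = (fun n => 2 * z ^+ 2 *
  series (fun n => n%:R * (z ^+ 2) ^+ n.-1) n + series (GRing.exp (z ^+ 2)) n)).
  apply: cvgD; last exact: cvg_series_pow.
  by apply: cvgM; [exact: cvg_cst|exact: cvg_series_deriv].
by apply/funext => n; rewrite !seriesEnat/= mulr_sumr -big_split.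
Qed.

Lemma geo_bounded_pseries_diffs r s f : 0 <= s < r ->
  geo_bounded s f -> geo_bounded r (pseries_diffs f).
Proof.
move=> /andP[s0 sr] [D D0 Df]; have r0 := le_lt_trans s0 sr.
have [E E0 Es] : geo_bounded r (fun m => m%:R * s ^+ m.-1).
  by apply: geo_bounded_deriv; rewrite ger0_norm.
exists (D * s * (E * r)); first by rewrite !mulr_ge0// ltW.
move=> n; rewrite /pseries_diffs normrM normr_nat.
rewrite (@le_trans _ _ (n.+1%:R * (D * s ^+ n.+1)))// ?ler_wpM2l//.
rewrite (_ : _ * _ = D * s * (n.+1%:R * s ^+ n)); last by rewrite exprS; ring.
rewrite -!mulrA ler_wpM2l// ler_wpM2l// -exprS.
by rewrite (le_trans _ (Es n.+1))// ler_norm.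
Qed.

Lemma cvg_pseries_geo_bounded s f z : 0 < s -> `|z| < s ->
  geo_bounded s^-1 f -> cvgn (pseries f z).
Proof.
move=> s0 zs fs; apply: (@geo_bounded_cvg (s^-1 * `|z|)).
  by rewrite mulr_ge0 ?invr_ge0 ?(ltW s0)//= mulrC ltr_pdivrMr// mul1r.
by apply: geo_boundedM => //; exact: geo_bounded_pow.
Qed.

Lemma cvg_series_pseries_deriv s f z : 0 < s -> `|z| < s -> geo_bounded s^-1 f ->
  series (fun m => m%:R * z ^+ m.-1 * f m) @ \oo --> limn (pseries (pseries_diffs f) z).
Proof.
move=> s0 zs fs; have [zr rs] := midf_lt zs; set r := (_ / 2) in zr rs.
have r0 : 0 < r by rewrite (le_lt_trans _ zr).
rewrite (_ : (fun m => _) = (fun m => m%:R * f m * z ^+ m.-1)); last first.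
  by apply/funext => m; ring.
apply: pseries_diffs_equiv; apply: (cvg_pseries_geo_bounded r0) => //.
by apply: geo_bounded_pseries_diffs fs; rewrite invr_ge0 (ltW s0)/= ltf_pV2.
Qed.

(** Termwise differentiation asks for convergence of the second derived series
    at a point beyond [z]; each derivation shrinks the radius a little, which
    the radii [c < b < a < s] absorb. *)
Lemma is_derive_pseries s f z : 0 < s -> `|z| < s -> geo_bounded s^-1 f ->
  is_derive z 1 (fun x => limn (pseries f x))
    (limn (series (fun m => m%:R * z ^+ m.-1 * f m))).
Proof.
move=> s0 zs fs; rewrite (cvg_lim _ (cvg_series_pseries_deriv s0 zs fs))//.
have [za a_s] := midf_lt zs; set a := (_ / 2) in za a_s.
have [zb ba] := midf_lt za; set b := (_ / 2) in zb ba.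
have [zc cb] := midf_lt zb; set c := (_ / 2) in zc cb.
have c0 : 0 < c by rewrite (le_lt_trans _ zc).
have b0 := lt_trans c0 cb; have a0 := lt_trans b0 ba.
have fa : geo_bounded a^-1 (pseries_diffs f).
  by apply: geo_bounded_pseries_diffs fs; rewrite invr_ge0 (ltW s0)/= ltf_pV2.
have fb : geo_bounded b^-1 (pseries_diffs (pseries_diffs f)).
  by apply: geo_bounded_pseries_diffs fa; rewrite invr_ge0 (ltW a0)/= ltf_pV2.
have nc : `|c| = c by rewrite ger0_norm ?ltW.
apply: (@pseries_snd_diffs _ _ c); rewrite ?nc//.
- by apply: cvg_pseries_geo_bounded fs; rewrite ?nc// (lt_trans cb)// (lt_trans ba).
- by apply: cvg_pseries_geo_bounded fa; rewrite ?nc// (lt_trans cb).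
- by apply: cvg_pseries_geo_bounded fb; rewrite ?nc.
Qed.

End GeometricBounds.

(** * Response of the two-node cycle along a sample path *)

Section CycleResponse.
Context {R : realType}.
Implicit Types (theta : 'rV[R]_2) (i k : 'I_2).

Definition loop_gain theta : R := theta 0 0 * theta 0 1.

Lemma loop_gainE theta i : loop_gain theta = theta 0 i * theta 0 (rev_ord i).
Proof.
rewrite /loop_gain; case: i => -[|[|//]] lt_i; last rewrite mulrC.
  by congr (theta 0 _ * theta 0 _); apply/val_inj.
by congr (theta 0 _ * theta 0 _); apply/val_inj.
Qed.

Lemma cycle_mxE theta i k :
  cycle_mx theta i k = if k == rev_ord i then theta 0 i else 0.
Proof.
rewrite mxE; case: i => -[|[|//]] lt_i; case: k => -[|[|//]] lt_k //=;
  by congr (theta 0 _); apply/val_inj.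
Qed.

Lemma tf_inv_cycle theta :
  tf_inv (tf_sub (tf_one R 2) (cycle_tf theta)) = fun n => cycle_mx theta ^+ n.
Proof.
set M := cycle_mx theta; set H := tf_sub _ _.
have H0 : H 0%N = 1%:M by rewrite /H /tf_sub /tf_one /cycle_tf/= subr0.
have H1 : H 1%N = - M by rewrite /H /tf_sub /tf_one /cycle_tf/= sub0r.
have H2 n : H n.+2 = 0 by rewrite /H /tf_sub /tf_one /cycle_tf/= subr0.
have mulH0 K : tf_mul H K 0%N = K 0%N.
  by rewrite /tf_mul big_ord_recl big_ord0 H0 mul1mx addr0.
have mulHS K n : tf_mul H K n.+1 = K n.+1 - M *m K n.
  rewrite /tf_mul big_ord_recl big_ord_recl big1/=; last first.
    by move=> j _; rewrite /bump/= !add1n H2 mul0mx.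
  by rewrite /bump/= H0 H1 mul1mx mulNmx addr0 subn0 add1n subSS subn0.
have mul0H K : tf_mul K H 0%N = K 0%N.
  by rewrite /tf_mul big_ord_recl big_ord0 H0 mulmx1 addr0.
have mulSH K n : tf_mul K H n.+1 = K n.+1 - K n *m M.
  rewrite /tf_mul !big_ord_recr/= big1/=; last first.
    case=> j /= jn _; rewrite (_ : (n.+1 - j)%N = (n - j.+1).+2) ?H2 ?mulmx0//.
    by rewrite subnS prednK ?subn_gt0// subSn// ltnW.
  by rewrite add0r subSnn subnn H0 H1 mulmx1 mulmxN addrC.
apply: xget_unique => [|K [HK _]].
  split; apply/funext => -[|n]; rewrite ?mulH0 ?mul0H ?expr0//.
    by rewrite mulHS exprS -mulmxE subrr.
  by rewrite mulSH exprSr -mulmxE subrr.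
apply/funext; elim=> [|n IHn]; first by rewrite -mulH0 HK.
by apply/eqP; rewrite -subr_eq0 exprS -IHn -mulmxE -mulHS HK.
Qed.

(** [cycle_mx theta ^+ n] sums the gains of the walks of length [n]. In a cycle a
    single walk of length [n] ends at node [i]: it runs [n./2] times around the
    loop and, for odd [n], once more through the edge into [i]. Note that
    [theta 0 i] is the gain of that edge and [rev_ord i] the other node. *)
Definition walk_gain theta i : R^nat :=
  interleave (GRing.exp (loop_gain theta)) (fun m => theta 0 i * loop_gain theta ^+ m).

Definition walk_source i n : 'I_2 := if odd n then rev_ord i else i.

Lemma cycle_mx_exp theta n (u : 'cV[R]_2) i :
  (cycle_mx theta ^+ n *m u) i 0 = walk_gain theta i n * u (walk_source i n) 0.
Proof.
have mulM (v : 'cV[R]_2) k : (cycle_mx theta *m v) k 0 = theta 0 k * v (rev_ord k) 0.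
  rewrite mxE (bigD1 (rev_ord k))//= cycle_mxE eqxx big1 ?addr0// => j jk.
  by rewrite cycle_mxE (negbTE jk) mul0r.
elim: n u i => [|n IHn] u i.
  by rewrite expr0 mul1mx /walk_gain /interleave/= expr0 mul1r.
rewrite exprS -mulmxE -mulmxA mulM IHn mulrA; congr (_ * u _ 0).
  rewrite /walk_gain /interleave /= uphalf_half; case: (odd n) => /=.
    by rewrite add1n exprS (loop_gainE _ i) mulrA.
  by rewrite add0n.
by rewrite /walk_source /=; case: (odd n); rewrite ?rev_ordK.
Qed.


(** The derivative of [walk_gain theta i] with respect to the parameter [k], whose
    cofactor in the loop gain is the parameter [rev_ord k]. *)
Definition walk_sens theta i k : R^nat :=
  let dloop m := theta 0 (rev_ord k) * (m%:R * loop_gain theta ^+ m.-1) in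
  interleave dloop (fun m => (k == i)%:R * loop_gain theta ^+ m + theta 0 i * dloop m).

Lemma geo_bounded_walk_sens theta i k r : 0 < r -> `|loop_gain theta| < r ^+ 2 ->
  geo_bounded r (walk_sens theta i k).
Proof.
move=> r0 zr; have d := geo_boundedZ (theta 0 (rev_ord k)) (geo_bounded_deriv zr).
apply: geo_bounded_interleave => //; apply: geo_boundedD; apply: geo_boundedZ => //.
by apply: geo_bounded_pow; exact: ltW.
Qed.

Definition response theta i (x : R^nat) : R :=
  limn (series (fun n => walk_gain theta i n * x n)).

(** Grouping the walks by parity turns the response into two power series in
    the loop gain, which can then be differentiated by the chain rule. *)
Lemma responseE theta i (x : R^nat) r : 0 < r -> geo_bounded r^-1 x ->
    `|loop_gain theta| < r ^+ 2 ->
  response theta i x = limn (pseries (fun m => x m.*2) (loop_gain theta)) +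
    theta 0 i * limn (pseries (fun m => x m.*2.+1) (loop_gain theta)).
Proof.
move=> r0 xr zr; have r2 : 0 < r ^+ 2 by rewrite exprn_gt0.
have xe : geo_bounded (r ^+ 2)^-1 (fun m => x m.*2).
  by rewrite -exprVn; exact: geo_bounded_even.
have xo : geo_bounded (r ^+ 2)^-1 (fun m => x m.*2.+1).
  by rewrite -exprVn; apply: geo_bounded_odd; rewrite ?invr_ge0 ?ltW.
rewrite /response (_ : (fun n => _) = interleave
    (fun m => x m.*2 * loop_gain theta ^+ m)
    (fun m => theta 0 i * (x m.*2.+1 * loop_gain theta ^+ m))).
  apply: cvg_lim => //; apply: cvg_series_interleave.
    exact: (cvg_pseries_geo_bounded r2 zr xe).
  rewrite (_ : series _ = (fun n => theta 0 i *
      pseries (fun m => x m.*2.+1) (loop_gain theta) n)); last first.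
    by apply/funext => n; rewrite /pseries !seriesEnat/= mulr_sumr.
  by apply: cvgM; [exact: cvg_cst|exact: (cvg_pseries_geo_bounded r2 zr xo)].
apply/funext => n; rewrite /walk_gain /interleave.
have -> : x n = x (odd n + n./2.*2)%N by rewrite odd_double_half.
by case: (odd n); rewrite ?add1n ?add0n; ring.
Qed.

Lemma is_derive_line (V : normedModType R) (f : V -> R) (a v : V) (df : R) :
  is_derive (0 : R) 1 (fun h => f (h *: v + a)) df -> is_derive a v f df.
Proof.
have E : (fun h : R => h^-1 *: (((fun h => f (h *: v + a)) \o shift 0) (h *: 1)
      - f (0 *: v + a)))
    = (fun h : R => h^-1 *: ((f \o shift a) (h *: v) - f a)).
  by apply/funext => h /=; rewrite addr0 scale0r add0r /GRing.scale/= mulr1.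
move=> [dphi <-]; move: dphi; rewrite /derivable E => dphi.
by apply: DeriveDef => //; rewrite /derive E.
Qed.


Lemma loop_gain_line theta k (h : R) :
  loop_gain (h *: delta_mx 0 k + theta) = h * theta 0 (rev_ord k) + loop_gain theta.
Proof.
have rk : (rev_ord k == k) = false by case: k => -[|[|]].
rewrite !(loop_gainE _ k) !mxE !eqxx rk /=. ring.
Qed.

(** Along the coordinate line through [theta] in direction [k] the loop gain is
    affine, as the two factors of the loop gain are distinct parameters. *)
Lemma derive_response theta i k (x : R^nat) r : 0 < r -> geo_bounded r^-1 x ->
    `|loop_gain theta| < r ^+ 2 ->
  'D_(delta_mx 0 k) (fun th => response th i x) theta =
  limn (series (fun n => walk_sens theta i k n * x n)).
Proof.
move=> r0 xr zr; have r2 : 0 < r ^+ 2 by rewrite exprn_gt0.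
have xe : geo_bounded (r ^+ 2)^-1 (fun m => x m.*2).
  by rewrite -exprVn; exact: geo_bounded_even.
have xo : geo_bounded (r ^+ 2)^-1 (fun m => x m.*2.+1).
  by rewrite -exprVn; apply: geo_bounded_odd; rewrite ?invr_ge0 ?ltW.
set z := loop_gain theta in zr *; set c := theta 0 (rev_ord k).
pose line (h : R) := h *: delta_mx 0 k + theta.
have lineE h : loop_gain (line h) = h * c + z by exact: loop_gain_line.
have line0 : line 0 = theta by rewrite /line scale0r add0r.
have dline a b : is_derive (0 : R) 1 (fun h : R => h * a + b) a.
  apply: (is_derive_eq (is_deriveD (is_deriveM (is_derive_id _ _)
    (is_derive_cst a _ _)) (is_derive_cst b _ _))).
  by rewrite /cst scaler0 add0r addr0 /GRing.scale/= mulr1.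
have near0 : \forall h \near (0 : R), `|h * c + z| < r ^+ 2.
  have c0 : (fun h : R => `|h * c + z|) @ (0 : R) --> `|0 * c + z|.
    apply: cvg_norm; apply: cvgD; last exact: cvg_cst.
    by apply: cvgM; [exact: cvg_id|exact: cvg_cst].
  by apply: (cvgr_lt _ c0); rewrite mul0r add0r.
have De := is_derive_pseries r2 zr xe; have Do := is_derive_pseries r2 zr xo.
set pe := limn _ in De; set po := limn _ in Do.
set Pe := (fun y => limn _) in De; set Po := (fun y => limn _) in Do.
pose phi h := Pe (h * c + z) + (h * (k == i)%:R + theta 0 i) * Po (h * c + z).
have dphi : is_derive (0 : R) 1 phi
    (c * pe + ((k == i)%:R * Po z + theta 0 i * (c * po))).
  have comp (P : R -> R) p : is_derive z 1 P p ->
      is_derive (0 : R) 1 (fun h => P (h * c + z)) (p * c).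
    move=> dP; apply: (is_derive1_comp (f := P) (g := fun h => h * c + z)).
    by rewrite mul0r add0r.
  apply: (is_derive_eq (is_deriveD (comp _ _ De) (is_deriveM (dline _ _) (comp _ _ Do)))).
  by rewrite /GRing.scale/= !mul0r !add0r; ring.
have -> : limn (series (fun n => walk_sens theta i k n * x n)) =
    c * pe + ((k == i)%:R * Po z + theta 0 i * (c * po)).
  have ce := cvg_series_pseries_deriv r2 zr xe.
  have co := cvg_series_pseries_deriv r2 zr xo.
  have cz : pseries (fun m => x m.*2.+1) z @ \oo --> Po z.
    exact: (cvg_pseries_geo_bounded r2 zr xo).
  rewrite /pe /po (cvg_lim _ ce)// (cvg_lim _ co)//.
  rewrite (_ : (fun n => _) = interleave
    (fun m => c * (m%:R * z ^+ m.-1 * x m.*2))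
    (fun m => (k == i)%:R * (x m.*2.+1 * z ^+ m) +
              theta 0 i * (c * (m%:R * z ^+ m.-1 * x m.*2.+1)))).
    apply: cvg_lim => //; apply: cvg_series_interleave.
      rewrite (_ : series _ = (fun n => c *
          series (fun m => m%:R * z ^+ m.-1 * x m.*2) n)); last first.
        by apply/funext => n; rewrite !seriesEnat/= mulr_sumr.
      by apply: cvgM => //; exact: cvg_cst.
    rewrite (_ : series _ = (fun n =>
        (k == i)%:R * pseries (fun m => x m.*2.+1) z n +
        theta 0 i * (c * series (fun m => m%:R * z ^+ m.-1 * x m.*2.+1) n))); last first.
      by apply/funext => n; rewrite /pseries !seriesEnat/= !mulr_sumr -big_split.
    apply: cvgD; apply: cvgM => //; try exact: cvg_cst.
    by apply: cvgM => //; exact: cvg_cst.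
  apply/funext => n; rewrite /walk_sens /interleave.
  have -> : x n = x (odd n + n./2.*2)%N by rewrite odd_double_half.
  by case: (odd n); rewrite ?add1n ?add0n -/z -/c; ring.
apply: derive_val; apply: is_derive_line; apply: near_eq_is_derive dphi.
near=> h; rewrite -/(line h) (responseE i r0 xr) ?lineE; last by near: h.
by rewrite /phi /Pe /Po /line !mxE eqxx /= [i == k]eq_sym.
Unshelve. all: by end_near.
Qed.

End CycleResponse.

(** * Integrals and means up to a null set *)

Section AlmostEverywhere.
Local Open Scope ereal_scope.
Context d (T : measurableType d) (R : realType).
Variable mu : {measure set T -> \bar R}.

Import HBNNSimple.

(** The integral of [f] is the supremum of the integrals of the simple functions
    below [f]; set to zero on the null set, such a function keeps its integral
    and lies below [g]. *)
Lemma ge0_ae_le_integralT (f g : T -> \bar R) : (forall x, 0 <= f x) ->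
  (forall x, 0 <= g x) -> {ae mu, forall x, f x = g x} ->
  \int[mu]_x f x <= \int[mu]_x g x.
Proof.
move=> f0 g0 [N [mN N0 fgN]]; rewrite !ge0_integralTE//.
apply: ge_ereal_sup => _ [h hf <-].
pose h' := proj_nnsfun h (measurableC mN).
have -> : sintegral mu h = sintegral mu h'.
  rewrite -!integralT_nnsfun; apply: ae_eq_integral => //.
  - exact/measurable_EFinP.
  - exact/measurable_EFinP.
  exists N; split => // x /= /not_implyP[_ hx]; apply: contrapT => Nx; apply: hx.
  by rewrite mindicE mem_set// mulr1.
apply: ereal_sup_ubound; exists h' => // x /=; rewrite mindicE.
have [|] := boolP (x \in ~` N); last by rewrite mulr0.
rewrite inE /= => Nx; rewrite mulr1 (le_trans (hf x))//.
suff -> : f x = g x by [].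
by apply: contrapT => fg; apply: Nx; apply: fgN.
Qed.

Lemma ae_eq_integralT (f g : T -> \bar R) :
  {ae mu, forall x, f x = g x} -> \int[mu]_x f x = \int[mu]_x g x.
Proof.
move=> fg; have gf : {ae mu, forall x, g x = f x} by apply: filterS fg.
rewrite integralE [RHS]integralE; congr (_ - _); apply/eqP; rewrite eq_le.
  by rewrite !ge0_ae_le_integralT//;
    [apply: filterS gf|apply: filterS fg] => x fgx; rewrite !funeposE fgx.
by rewrite !ge0_ae_le_integralT//;
  [apply: filterS gf|apply: filterS fg] => x fgx; rewrite !funenegE fgx.
Qed.

End AlmostEverywhere.

Section Mean.
Context d (T : measurableType d) (R : realType) (P : probability T R).

Definition has_mean (f : T -> R) (m : R) :=
  P.-integrable setT (EFin \o f) /\ ('E_P[f] = m%:E)%E.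

Lemma has_mean0 f : (forall w, f w = 0) -> has_mean f 0.
Proof.
move=> /funext ->; split; [exact: integrable0|exact: expectation_cst].
Qed.

Lemma has_meanD f g (m n : R) :
  has_mean f m -> has_mean g n -> has_mean (fun w => f w + g w) (m + n).
Proof.
move=> [If Ef] [Ig Eg]; split; first exact: (integrableD measurableT If Ig).
by rewrite EFinD -Ef -Eg unlock integralD_EFin.
Qed.

Lemma has_meanZ c f (m : R) : has_mean f m -> has_mean (fun w => c * f w) (c * m).
Proof.
move=> [If Ef]; split; first exact: (integrableZl measurableT c If).
by rewrite EFinM -Ef unlock -integralZl.
Qed.

Lemma has_mean_sum n (f : 'I_n -> T -> R) (m : 'I_n -> R) :
  (forall i, has_mean (f i) (m i)) ->
  has_mean (fun w => \sum_(i < n) f i w) (\sum_(i < n) m i).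
Proof.
elim: n f m => [|n IHn] f m fm.
  by rewrite big_ord0; apply: has_mean0 => w; rewrite big_ord0.
under eq_fun do rewrite big_ord_recr; rewrite big_ord_recr.
by apply: has_meanD => //; exact: IHn.
Qed.

(** The predictor is given by a convergent series only almost surely; on the
    exceptional null set its derivative is arbitrary and may fail to be
    measurable. Means are therefore computed on an integrable representative. *)
Definition ae_has_mean (f : T -> R) (m : R) :=
  exists2 h, has_mean h m & {ae P, forall w, f w = h w}.

Lemma ae_has_meanE f m : ae_has_mean f m -> ('E_P[f] = m%:E)%E.
Proof.
move=> [h [_ <-] fh]; rewrite unlock; apply: ae_eq_integralT.
by apply: filterS fh => w ->.
Qed.

Lemma ae_has_mean_ae f g m :
  {ae P, forall w, f w = g w} -> ae_has_mean g m -> ae_has_mean f m.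
Proof.
by move=> fg [h hm gh]; exists h => //; apply: filterS2 fg gh => w -> ->.
Qed.

Lemma ae_has_meanZ c f m : ae_has_mean f m -> ae_has_mean (fun w => c * f w) (c * m).
Proof.
move=> [h hm fh]; exists (fun w => c * h w); first exact: has_meanZ.
by apply: filterS fh => w ->.
Qed.

Lemma ae_has_mean_sum n (f : 'I_n -> T -> R) (m : 'I_n -> R) :
  (forall i, ae_has_mean (f i) (m i)) ->
  ae_has_mean (fun w => \sum_(i < n) f i w) (\sum_(i < n) m i).
Proof.
move=> /(_ _)/cid2 fm; exists (fun w => \sum_(i < n) sval (fm i) w).
  by apply: has_mean_sum => i; case: (fm i).
have : {ae P, forall w, forall i, f i w = sval (fm i) w}.
  by apply: filter_forall => i; case: (fm i).
by apply: filterS => w fw; apply: eq_bigr.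
Qed.

End Mean.

(** * Second moments of series of uncorrelated variables *)

Lemma weighted_cauchy_schwarz (R : realType) (k y : R^nat) n :
  (forall i, 0 <= k i) ->
  (\sum_(0 <= i < n) k i * y i) ^+ 2 <=
  (\sum_(0 <= i < n) k i) * \sum_(0 <= i < n) k i * y i ^+ 2.
Proof.
move=> k_ge0; elim: n => [|n IHn]; first by rewrite !big_nil expr0n mul0r.
rewrite !big_nat_recr//=; move: IHn.
have : 0 <= \sum_(0 <= i < n) k i by exact: sumr_ge0.
have : 0 <= \sum_(0 <= i < n) k i * y i ^+ 2.
  by apply: sumr_ge0 => i _; rewrite mulr_ge0 ?sqr_ge0.
set A := \sum_(_ <= _ < _) k _; set B := \sum_(_ <= _ < _) (k _ * _ ^+ 2).
set S := \sum_(_ <= _ < _) _ => B0 A0 SAB.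
have Ay0 : 0 <= A * y n ^+ 2 by apply: mulr_ge0 => //; exact: sqr_ge0.
have amgm : 2 * (S * y n) <= A * y n ^+ 2 + B.
  rewrite (le_trans (ler_norm _))// -ler_sqr ?nnegrE ?addr_ge0//.
  rewrite real_normK ?num_real//; have := sqr_ge0 (A * y n ^+ 2 - B).
  by have := ler_wpM2r (sqr_ge0 (y n)) SAB; nra.
by have := ler_wpM2l (k_ge0 n) amgm; nra.
Qed.

Section UncorrelatedSeries.
Context d (T : measurableType d) (R : realType) (P : probability T R).
Variables (X : nat -> T -> R) (s : R^nat) (kappa v : R).
Hypothesis X_mean : forall n m,
  has_mean P (fun w => X n w * X m w) (if n == m then s n else 0).
Hypothesis mX : forall n, measurable_fun setT (X n).
Hypothesis s_le : forall n, s n <= v.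
Hypothesis kappa01 : 0 < kappa < 1.

Let k0 : 0 < kappa. Proof. by case/andP: kappa01. Qed.
Let k1 : kappa < 1. Proof. by case/andP: kappa01. Qed.

(** Its mean is at most [v / (1 - kappa)], so it is almost surely finite. Where
   it is finite, it bounds the growth of [X ^~ w] and the partial sums of all
   series [alpha n * X n w] with [alpha] bounded by powers of [kappa]. *)
Let energy (w : T) : \bar R := (\sum_(0 <= n <oo) (kappa ^+ n * X n w ^+ 2)%:E)%E.

Let energy_ge0 n w : 0 <= kappa ^+ n * X n w ^+ 2.
Proof. by apply: mulr_ge0; [exact/exprn_ge0/ltW|exact: sqr_ge0]. Qed.

Let measurable_term n : measurable_fun setT (fun w => (kappa ^+ n * X n w ^+ 2)%:E).
Proof.
apply/measurable_EFinP.
apply: measurable_funM => //; under eq_fun do rewrite expr2.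
exact: measurable_funM.
Qed.

Let integral_term n : (\int[P]_w (kappa ^+ n * X n w ^+ 2)%:E = (kappa ^+ n * s n)%:E)%E.
Proof.
have [_] := has_meanZ (kappa ^+ n) (X_mean n n); rewrite eqxx unlock => <-.
by apply: eq_integral => w _; rewrite expr2.
Qed.

Let s_ge0 n : 0 <= s n.
Proof.
have [_] := X_mean n n; rewrite eqxx -lee_fin => <-.
by apply: expectation_ge0 => w; rewrite -expr2 sqr_ge0.
Qed.

Let integrable_energy : P.-integrable setT energy.
Proof.
apply/integrableP; split.
  apply: ge0_emeasurable_sum => // n w _ _.
  by rewrite lee_fin.
have -> : (\int[P]_w `|energy w| = \int[P]_w energy w)%E.
  apply: eq_integral => w _; rewrite gee0_abs//.
  by apply: nneseries_ge0 => n _ _; rewrite lee_fin.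
rewrite /energy integral_nneseries//; last by move=> n w _; rewrite lee_fin.
apply: (@le_lt_trans _ _ (v / (1 - kappa))%:E); last exact: ltry.
apply: lime_le.
  by apply: is_cvg_nneseries => n _ _; apply: integral_ge0 => w _; rewrite lee_fin.
apply: nearW => n; under eq_bigr do rewrite integral_term.
rewrite sumEFin lee_fin.
have v0 : 0 <= v by exact: le_trans (s_ge0 0) (s_le 0).
apply: (@le_trans _ _ (\sum_(0 <= i < n) v * kappa ^+ i)).
  by apply: ler_sum => i _; rewrite mulrC ler_wpM2r// exprn_ge0// ltW.
rewrite -mulr_sumr ler_wpM2l// -[\sum_(_ <= _ < _) _]/(series (GRing.exp kappa) n).
rewrite exprn_geometric geometric_seriesE ?lt_eqF//= mul1r ler_pdivrMr ?subr_gt0//.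
by rewrite mulVf ?gt_eqF ?subr_gt0// gerBl exprn_ge0// ltW.
Qed.

Let energy_fin : {ae P, forall w, energy w \is a fin_num}.
Proof.
by have := integrable_ae measurableT integrable_energy; apply: filterS => w; apply.
Qed.

Let partial_energy w n : energy w \is a fin_num ->
  \sum_(0 <= i < n) kappa ^+ i * X i w ^+ 2 <= fine (energy w).
Proof.
move=> wfin; rewrite -lee_fin fineK// -sumEFin.
by apply: nneseries_lim_ge => i _; rewrite lee_fin.
Qed.

Lemma ae_geo_bounded : {ae P, forall w, geo_bounded kappa^-1 (X ^~ w)}.
Proof.
apply: filterS energy_fin => w wfin; exists (1 + fine (energy w)).
  rewrite addr_ge0// fine_ge0//.
  by apply: nneseries_ge0 => n _ _; rewrite lee_fin.
move=> n; rewrite exprVn ler_pdivlMr ?exprn_gt0//.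
have Xe : kappa ^+ n * X n w ^+ 2 <= fine (energy w).
  apply: le_trans (partial_energy n.+1 wfin).
  by rewrite big_nat_recr//= lerDr sumr_ge0.
rewrite (@le_trans _ _ ((1 + X n w ^+ 2) * kappa ^+ n))//.
  rewrite ler_wpM2r ?exprn_ge0 ?(ltW k0)//.
  rewrite -real_normK ?num_real//; have := sqr_ge0 (`|X n w| - 1 / 2); nra.
rewrite mulrDl mul1r lerD// 1?mulrC//.
by rewrite exprn_ile1 ?ltW.
Qed.

Lemma series_le_energy (alpha : R^nat) D w n :
  0 <= D -> (forall i, `|alpha i| <= D * kappa ^+ i) -> energy w \is a fin_num ->
  `|series (fun i => alpha i * X i w) n| <=
  D * Num.sqrt ((1 - kappa)^-1 * fine (energy w)).
Proof.
move=> D0 Da wfin.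
rewrite (@le_trans _ _ (D * \sum_(0 <= i < n) kappa ^+ i * `|X i w|))//.
  rewrite (le_trans (ler_norm_sum _ _ _))// mulr_sumr ler_sum// => i _.
  by rewrite normrM mulrA ler_wpM2r.
have K0 : 0 <= (1 - kappa)^-1 by rewrite invr_ge0 subr_ge0 ltW.
have e0 : 0 <= fine (energy w).
  by apply/fine_ge0/nneseries_ge0 => i _ _; rewrite lee_fin.
rewrite ler_wpM2l//; apply: (le_trans (ler_norm _)).
rewrite -sqrtr_sqr ler_wsqrtr//.
rewrite (le_trans (weighted_cauchy_schwarz _ _ _))//; first by move=> i; exact/exprn_ge0/ltW.
rewrite ler_pM//.
- by apply: sumr_ge0 => i _; exact/exprn_ge0/ltW.
- by apply: sumr_ge0 => i _; rewrite real_normK ?num_real.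
- rewrite -[leLHS]/(series (GRing.exp kappa) n) exprn_geometric geometric_seriesE ?lt_eqF//=.
  by rewrite mul1r ler_pdivrMr ?subr_gt0// mulVf ?gt_eqF ?subr_gt0// gerBl exprn_ge0// ltW.
- rewrite (le_trans _ (partial_energy n wfin))// ler_sum// => i _.
  by rewrite real_normK ?num_real.
Qed.

(** For partial sums the formula is bilinearity. Their products are dominated by
    a multiple of [energy], which is integrable, so the limit passes through the
    mean. *)
Lemma ae_has_mean_series (alpha beta : R^nat) r : 0 < r < kappa ->
    geo_bounded r alpha -> geo_bounded r beta ->
  ae_has_mean P (fun w => limn (series (fun n => alpha n * X n w)) *
                          limn (series (fun n => beta n * X n w)))
    (limn (series (fun n => alpha n * beta n * s n))).
Proof.
move=> /andP[r0 rk] ar br.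
have rk' : 0 <= r <= kappa by rewrite !ltW.
have [D D0 Da] := geo_bounded_le rk' ar; have [E E0 Eb] := geo_bounded_le rk' br.
pose SS n w := series (fun i => alpha i * X i w) n * series (fun i => beta i * X i w) n.
have SS_mean n : has_mean P (SS n) (series (fun i => alpha i * beta i * s i) n).
  rewrite (_ : SS n = fun w => \sum_(i < n) \sum_(j < n)
      alpha i * beta j * (X i w * X j w)); last first.
    apply/funext => w; rewrite /SS /series/= !big_mkord big_distrlr/=.
    by apply: eq_bigr => i _; apply: eq_bigr => j _; rewrite mulrACA.
  rewrite /series/= big_mkord.
  apply: has_mean_sum => i.
  rewrite (_ : _ * s i = \sum_(j < n) alpha i * beta j * (if i == j then s i else 0)).
    by apply: has_mean_sum => j; apply: has_meanZ; exact: X_mean.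
  rewrite (bigD1 i)//= eqxx big1 ?addr0// => j ji.
  by rewrite eq_sym (negbTE ji) mulr0.
have [N [mN N0 subN]] : {ae P, forall w,
    energy w \is a fin_num /\ geo_bounded kappa^-1 (X ^~ w)}.
  by apply: filterS2 energy_fin ae_geo_bounded.
have good w : ~ N w -> energy w \is a fin_num /\ geo_bounded kappa^-1 (X ^~ w).
  by move=> Nw; apply: contrapT => bad; apply: Nw; apply: subN.
pose lim_ w := limn (series (fun n => alpha n * X n w)) *
               limn (series (fun n => beta n * X n w)).
have SS_cvg w : ~ N w -> SS ^~ w @ \oo --> lim_ w.
  move=> /good[_ Xw].
  have rk1 : 0 <= r / kappa < 1 by rewrite divr_ge0 ?ltW//= ltr_pdivrMr// mul1r.
  by apply: cvgM; apply: geo_bounded_cvg rk1 _; exact: geo_boundedM.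
pose h w := lim_ w * \1_(~` N) w.
have mSS n : measurable_fun setT (SS n).
  by have [/integrableP[/measurable_EFinP]] := SS_mean n.
have mh : measurable_fun setT h.
  apply: (measurable_fun_cvg (h := fun n w => SS n w * \1_(~` N) w)).
    by move=> n; apply: measurable_funM => //; exact/measurable_indic/measurableC.
  move=> w _; rewrite /h indicE; have [|] := boolP (w \in ~` N).
    by rewrite inE => /SS_cvg Sw; apply: cvgM => //; exact: cvg_cst.
  by move=> _; under eq_fun do rewrite mulr0; rewrite mulr0; exact: cvg_cst.
have hE w : ~ N w -> h w = lim_ w by move=> Nw; rewrite /h indicE mem_set// mulr1.
have SS_ae : {ae P, forall w, setT w -> (EFin \o SS n) w @[n --> \oo] --> (EFin \o h) w}.
  exists N; split => // w /= /not_implyP[_ Sw]; apply: contrapT => Nw; apply: Sw.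
  by rewrite hE//; apply: cvg_EFin; [exact: nearW|exact: SS_cvg].
have Ibound : P.-integrable setT (fun w => (D * E / (1 - kappa))%:E * energy w)%E.
  exact: (integrableZl measurableT).
have SS_bound : {ae P, forall w n, setT w ->
    (`|(EFin \o SS n) w| <= (D * E / (1 - kappa))%:E * energy w)%E}.
  apply: filterS energy_fin => w wfin n _; rewrite -(fineK wfin) -EFinM lee_fin.
  have e0 : 0 <= (1 - kappa)^-1 * fine (energy w).
    rewrite mulr_ge0 ?invr_ge0 ?subr_ge0 ?(ltW k1)//.
    by apply/fine_ge0/nneseries_ge0 => i _ _; rewrite lee_fin.
  rewrite normrM (le_trans (ler_pM _ _ (series_le_energy n D0 Da wfin)
    (series_le_energy n E0 Eb wfin)))//.
  by rewrite mulrACA -expr2 sqr_sqrtr// mulrA.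
have [Ih _ EE] := dominated_convergence measurableT
  (fun n => (measurable_EFinP _ _).2 (mSS n)) ((measurable_EFinP _ _).2 mh)
  SS_ae Ibound SS_bound.
exists h; last by exists N; split => // w /= hw; apply: contrapT => Nw; apply: hw; rewrite hE.
split => //; rewrite unlock; apply/esym; rewrite -(cvg_lim _ EE)//.
rewrite -EFin_lim//.
  congr (limn _); apply/funext => n /=.
  by have [_ <-] := SS_mean n; rewrite unlock.
apply: (@geo_bounded_cvg _ (r * r * 1)).
  by rewrite mulr1 mulr_ge0 ?(ltW r0)//= mulr_ilt1 ?(ltW r0)// (lt_trans rk).
apply: geo_boundedM; first exact: geo_boundedM.
exists v; first exact: le_trans (s_ge0 0) (s_le 0).
by move=> n; rewrite expr1n mulr1 ger0_norm.
Qed.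

End UncorrelatedSeries.

(** * Means of products of independent variables *)

Section Independence.
Local Open Scope ereal_scope.
Context d (T : measurableType d) (R : realType) (P : probability T R).

(** The product rule says that the joint law agrees with the product of the laws
    on rectangles, hence everywhere; Fubini then separates the integral of [x y]. *)
Lemma expectation_prod (X Y : {RV P >-> R}) :
  (X : T -> R) \in Lfun P 2%:E -> (Y : T -> R) \in Lfun P 2%:E ->
  (forall A B : set R, measurable A -> measurable B ->
    P (X @^-1` A `&` Y @^-1` B) = P (X @^-1` A) * P (Y @^-1` B)) ->
  'E_P[X * Y] = 'E_P[X] * 'E_P[Y].
Proof.
move=> X2 Y2 indep.
have X1 : (X : T -> R) \in Lfun P 1 by apply: Lfun_subset12 => //; exact: fin_num_measure.
have Y1 : (Y : T -> R) \in Lfun P 1 by apply: Lfun_subset12 => //; exact: fin_num_measure.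
have XY1 := Lfun2_mul_Lfun1 X2 Y2.
pose Z w := (X w, Y w).
have mZ : measurable_fun setT Z by exact/measurable_fun_pair.
pose Zm : {mfun T >-> (R * R)%type} := mfun_Sub (mem_set mZ).
pose PZ : probability _ R := distribution P Zm.
pose PX : probability _ R := distribution P X.
pose PY : probability _ R := distribution P Y.
pose f (z : R * R) := (z.1 * z.2)%:E.
have mf : measurable_fun setT f.
  by apply/measurable_EFinP; apply: measurable_funM.
have fZ : P.-integrable setT (f \o Z) by exact/Lfun1_integrable.
have PZE : forall A, measurable A -> (PX \x PY) A = PZ A.
  apply: product_measure_unique => A B mA mB.
  exact: indep.
have If : (PX \x PY).-integrable setT f.
  apply/integrableP; split => //.
  have /integrableP[_ fin] : PZ.-integrable setT f by exact: integrable_pushforward.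
  rewrite (eq_measure_integral PZ)// => A mA _; exact: PZE.
rewrite unlock.
transitivity (\int[PZ]_z f z).
  by rewrite integral_pushforward.
transitivity (\int[PX \x PY]_z f z).
  by apply: eq_measure_integral => A mA _; exact/esym/PZE.
have IX : PX.-integrable setT (fun x => x%:E).
  by apply: integrable_pushforward => //; [exact/measurable_EFinP|exact/Lfun1_integrable].
have IY : PY.-integrable setT (fun y => y%:E).
  by apply: integrable_pushforward => //; [exact/measurable_EFinP|exact/Lfun1_integrable].
have EX : \int[PX]_x x%:E = \int[P]_w (X w)%:E.
  by rewrite integral_pushforward//; exact/Lfun1_integrable.
have EY : \int[PY]_y y%:E = \int[P]_w (Y w)%:E.
  by rewrite integral_pushforward//; exact/Lfun1_integrable.
rewrite -integral12_prod_meas1//.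
have Yfin : \int[P]_w (Y w)%:E \is a fin_num.
  by apply: integrable_fin_num => //; exact/Lfun1_integrable.
rewrite -EX -[in RHS](fineK Yfin) -integralZr//.
apply: eq_integral => x _; rewrite fineK// -EY /fubini_F /f/=.
by under eq_integral do rewrite EFinM; rewrite integralZl.
Qed.

End Independence.

(** * Information matrix of a pattern *)

Section Experiment.
Context {R : realType} (B C : {set 'I_2}) (sigma2 lambda : R).
Variable E : experiment B C (fun=> sigma2) (fun=> lambda).
Let P := exp_prob E.
Implicit Types (theta : 'rV[R]_2) (t : int) (i k l : 'I_2).

Definition input i t (w : exp_space E) : R := if i \in B then exc E i t w else 0.

Lemma excitation_inputE t w i : (excitation_mx R B *m excitation t w) i 0 = input i t w.
Proof.
rewrite mxE /input; case: ifPn => iB.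
  rewrite (bigD1 (enum_rank_in iB i))//= !mxE enum_rankK_in// eqxx mul1r.
  rewrite big1 ?addr0// => m mi; rewrite !mxE; case: eqP => [im|_]; last by rewrite mul0r.
  by move/eqP: mi; case; apply: enum_val_inj; rewrite enum_rankK_in.
apply: big1 => m _; rewrite !mxE; case: eqP => [im|_]; last by rewrite mul0r.
by rewrite im enum_valP in iB.
Qed.

Lemma measurable_input i t : measurable_fun setT (input i t).
Proof. by rewrite /input; case: (i \in B). Qed.

Lemma independent_exc i j t s (U V : set R) :
    i \in B -> j \in B -> i != j -> measurable U -> measurable V ->
  (P (exc E i t @^-1` U `&` exc E j s @^-1` V) =
   P (exc E i t @^-1` U) * P (exc E j s @^-1` V))%E.
Proof.
move=> iB jB ij mU mV.
pose A l := if l == i then exc E i t @^-1` U else if l == j then exc E j s @^-1` V else setT.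
have : independent_processes B (exc E) by exact: exc_indep.
move=> /(_ A).
have -> : \big[setI/setT]_(l in B) A l = exc E i t @^-1` U `&` exc E j s @^-1` V.
  rewrite (bigD1 i)//= (bigD1 j) ?jB 1?eq_sym//= big1.
    by rewrite setIT /A eqxx eq_sym (negbTE ij) eqxx.
  by move=> l /andP[/andP[_ li] lj]; rewrite /A (negbTE li) (negbTE lj).
have -> : (\prod_(l in B) P (A l) = P (exc E i t @^-1` U) * P (exc E j s @^-1` V))%E.
  rewrite (bigD1 i)//= (bigD1 j) ?jB 1?eq_sym//= big1.
    by rewrite mule1 /A eqxx eq_sym (negbTE ij) eqxx.
  move=> l /andP[/andP[_ li] lj]; rewrite /A (negbTE li) (negbTE lj).
  exact: probability_setT.
apply=> l _; apply: sub_sigma_algebra; rewrite /A.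
case: eqP => [->|_]; first by exists t, U.
case: eqP => [->|_]; first by exists s, V.
by exists t, setT; rewrite preimage_setT.
Qed.

Lemma input_mean i j t s : has_mean P (fun w => input i t w * input j s w)
  (if (i == j) && (t == s) then (i \in B)%:R * sigma2 else 0).
Proof.
have [iB|iB] := boolP (i \in B); last first.
  rewrite /input (negbTE iB) mul0r if_same.
  by apply: has_mean0 => w; rewrite mul0r.
have [jB|jB] := boolP (j \in B); last first.
  rewrite /input (negbTE jB); case: eqP => [ij|_]; first by rewrite -ij iB in jB.
  by apply: has_mean0 => w; rewrite mulr0.
have [i2 i0 ic] := exc_white E iB; have [j2 j0 jc] := exc_white E jB.
rewrite /input iB jB mul1r.
have L1 := Lfun2_mul_Lfun1 (i2 t) (j2 s).
split; first exact/Lfun1_integrable.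
have [ij|ij] := eqVneq i j; last first.
  transitivity ('E_P[exc E i t] * 'E_P[exc E j s])%E; last by rewrite i0 mul0e.
  by apply: expectation_prod => // U V mU mV; exact: independent_exc.
have f1 X : X \in Lfun P 2%:E -> X \in Lfun P 1.
  by move=> X2; apply: Lfun_subset12 => //; exact: fin_num_measure.
subst j; rewrite /= -ic (covarianceE (f1 _ (i2 t)) (f1 _ (i2 s)) L1).
by rewrite i0 mul0e sube0.
Qed.

(** The excitation that reaches node [i] at time [t] along the walk of length [n]. *)
Definition delayed i t n (w : exp_space E) : R := input (walk_source i n) (t - n%:Z) w.

Lemma predictorE theta t w j :
  predictor theta t w j 0 = response theta (enum_val j) (fun n => delayed (enum_val j) t n w).
Proof.
rewrite /predictor mxE (bigD1 (enum_val j))//= mxE eqxx mul1r big1 ?addr0; last first.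
  by move=> i ij; rewrite mxE (negbTE ij) mul0r.
rewrite mxE tf_inv_cycle /response; congr (limn (series _)).
by apply/funext => n; rewrite cycle_mx_exp excitation_inputE.
Qed.


(** The walks of different lengths ending at [i] carry excitations of different
    times, so whiteness and independence leave only the diagonal terms. *)
Lemma delayed_mean i t n m : has_mean P (fun w => delayed i t n w * delayed i t m w)
  (if n == m then (walk_source i n \in B)%:R * sigma2 else 0).
Proof.
have := input_mean (walk_source i n) (walk_source i m) (t - n%:Z) (t - m%:Z).
have [->|nm] := eqVneq n m; first by rewrite !eqxx.
rewrite (_ : (t - n%:Z == t - m%:Z) = false) ?andbF//.
by rewrite (inj_eq (addrI t)) eqr_opp eqz_nat; exact: negbTE.
Qed.

Lemma sensitivityE theta t w k j r : 0 < r -> `|loop_gain theta| < r ^+ 2 ->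
    geo_bounded r^-1 (fun n => delayed (enum_val j) t n w) ->
  sensitivity theta t w k j =
  limn (series (fun n => walk_sens theta (enum_val j) k n * delayed (enum_val j) t n w)).
Proof.
move=> r0 zr xr; rewrite mxE -(derive_response _ _ r0 xr zr).
by under eq_fun do rewrite predictorE.
Qed.

(** The inputs delayed by different times are uncorrelated, so only products of
    coefficients of the same walk contribute; every output adds its own sum. *)
Lemma information_mxE theta t k l : 0 <= sigma2 -> `|loop_gain theta| < 1 ->
  information_mx E theta t k l = lambda^-1 * \sum_(i in C)
    limn (series (fun n => walk_sens theta i k n * walk_sens theta i l n *
                           ((walk_source i n \in B)%:R * sigma2))).
Proof.
move=> sigma2_ge0 z1.
(* A walk of length [n] has gain of order [|z|^(n/2)], whence a rate [r] with
   [|z| < r^2]; the room between [r] and [kappa] makes the series in the inputs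
   converge, the inputs being almost surely [O(kappa^-n)]. *)
have [zrho rho1] := midf_lt z1; set rho := (_ / 2) in zrho rho1.
have rho0 : 0 < rho by exact: le_lt_trans zrho.
pose r := Num.sqrt rho.
have r2 : r ^+ 2 = rho by rewrite sqr_sqrtr// ltW.
have r0 : 0 < r by rewrite sqrtr_gt0.
have r1 : r < 1 by rewrite -sqrtr1 ltr_sqrt.
have [rk k1] := midf_lt r1; set kappa := (_ / 2) in rk k1.
have k0 : 0 < kappa by exact: lt_trans rk.
have zk : `|loop_gain theta| < kappa ^+ 2.
  by rewrite (lt_trans zrho)// -r2 ltr_pXn2r// nnegrE ltW.
have k01 : 0 < kappa < 1 by rewrite k0 k1.
have r0k : 0 < r < kappa by rewrite r0 rk.
have ws i k' : geo_bounded r (walk_sens theta i k').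
  by apply: geo_bounded_walk_sens => //; rewrite r2.
have mX i n : measurable_fun setT (delayed i t n) by exact: measurable_input.
have s_le i n : (walk_source i n \in B)%:R * sigma2 <= sigma2.
  by case: (_ \in B); rewrite ?mul1r// mul0r.
rewrite mxE big_enum_val mulr_sumr.
rewrite (_ : 'E_(_)[_] = (\sum_(j < #|C|) lambda^-1 * limn (series (fun n =>
   walk_sens theta (enum_val j) k n * walk_sens theta (enum_val j) l n *
   ((walk_source (enum_val j) n \in B)%:R * sigma2))))%:E)%E//.
apply: ae_has_meanE; pose S (j : 'I_#|C|) k' w := limn (series (fun n =>
  walk_sens theta (enum_val j) k' n * delayed (enum_val j) t n w)).
apply: (ae_has_mean_ae (g :=
  fun w => \sum_(j < #|C|) lambda^-1 * (S j k w * S j l w))); last first.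
  apply: ae_has_mean_sum => j; apply: ae_has_meanZ.
  exact: (ae_has_mean_series (delayed_mean (enum_val j) t) (mX _) (s_le _) k01 r0k).
have : {ae P, forall w, forall j : 'I_#|C|,
    geo_bounded kappa^-1 (fun n => delayed (enum_val j) t n w)}.
  apply: filter_forall => j.
  exact: (ae_geo_bounded (delayed_mean (enum_val j) t) (mX _) (s_le _) k01).
apply: filterS => w xw.
rewrite (_ : noise_cov_mx C _ = lambda%:M); last first.
  by apply/matrixP => i j; rewrite !mxE.
have entryZ (S' : 'M[R]_(2, #|C|)) c i j : (c *: S') i j = c * S' i j by rewrite mxE.
have entryT (S' : 'M[R]_(2, #|C|)) j i : S'^T j i = S' i j by rewrite mxE.
rewrite invmx_scalar mul_mx_scalar mxE; apply: eq_bigr => j _.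
by rewrite entryZ entryT -mulrA !(sensitivityE _ k0 zk (xw j)).
Qed.

End Experiment.

(** * Closed forms and comparison of the patterns *)

Section ClosedForm.
Context {R : realType}.
Implicit Types (theta : 'rV[R]_2) (t : int) (i k l : 'I_2).

(** The information, for unit variances, that the measurement of a node carries
    about the parameters [k] and [l] when that node is excited: the sum over the
    walks of even length. It is the same for both nodes. *)
Definition same_node_info theta k l : R :=
  let z := loop_gain theta in
  theta 0 (rev_ord k) * theta 0 (rev_ord l) * ((1 + z ^+ 2) / (1 - z ^+ 2) ^+ 3).

(** The same quantity when node [i] is measured and the other node is excited: the
    sum over the walks of odd length, which use the edge into [i] once more. *)
Definition other_node_info theta i k l : R :=
  let z := loop_gain theta in
  (k == i)%:R * (l == i)%:R / (1 - z ^+ 2) +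
  ((k == i)%:R * theta 0 (rev_ord l) + (l == i)%:R * theta 0 (rev_ord k)) *
    theta 0 i * z / (1 - z ^+ 2) ^+ 2 +
  theta 0 i ^+ 2 * same_node_info theta k l.

(** The products of walk sensitivities are combinations of the three sequences
    [z^m z^m], [z^m d m] and [(d m)^2], where [d m] is the derivative of [z^m]. *)
Lemma series_walk_sens theta (B : {set 'I_2}) sigma2 i k l : `|loop_gain theta| < 1 ->
  limn (series (fun n => walk_sens theta i k n * walk_sens theta i l n *
                           ((walk_source i n \in B)%:R * sigma2))) =
  ((i \in B)%:R * same_node_info theta k l +
   (rev_ord i \in B)%:R * other_node_info theta i k l) * sigma2.
Proof.
move=> z1; rewrite /other_node_info /same_node_info.
set z := loop_gain theta in z1 *; set u := 1 - z ^+ 2.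
set p := theta 0 (rev_ord k); set q := theta 0 (rev_ord l).
pose d m : R := m%:R * z ^+ m.-1.
have z2 : `|z ^+ 2| < 1 by rewrite normrX exprn_ilt1.
have cZ c (f : R^nat) (y : R) : series f @ \oo --> y ->
    series (fun m => c * f m) @ \oo --> c * y.
  move=> fy; rewrite (_ : series _ = (fun n => c * series f n)).
    by apply: cvgM => //; exact: cvg_cst.
  by apply/funext => n; rewrite !seriesEnat/= mulr_sumr.
have cD (f g : R^nat) (y y' : R) : series f @ \oo --> y -> series g @ \oo --> y' ->
    series (fun m => f m + g m) @ \oo --> y + y'.
  move=> fy gy; rewrite (_ : series _ = series f \+ series g); first exact: cvgD.
  by apply/funext => n; rewrite !seriesEnat/= -big_split.
have s00 : series (fun m => z ^+ m * z ^+ m) @ \oo --> u^-1.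
  rewrite (_ : (fun m => _) = GRing.exp (z ^+ 2)); first exact: cvg_series_pow.
  by apply/funext => m; rewrite -exprD addnn -mul2n exprM.
have s01 : series (fun m => z ^+ m * d m) @ \oo --> z * u ^- 2.
  rewrite (_ : (fun m => _) = (fun m => z * (m%:R * (z ^+ 2) ^+ m.-1))).
    by apply: cZ; exact: cvg_series_deriv.
  apply/funext => -[|m]; rewrite /d ?mul0r ?mulr0//= mulrCA -exprD addSn exprS.
  by rewrite -exprM mulrCA addnn mul2n.
have s11 : series (fun m => d m ^+ 2) @ \oo --> (1 + z ^+ 2) / u ^+ 3.
  exact: cvg_series_deriv_sqr.
pose f m := (i \in B)%:R * sigma2 * (p * q) * d m ^+ 2.
pose g m := (rev_ord i \in B)%:R * sigma2 *
  ((k == i)%:R * (l == i)%:R * (z ^+ m * z ^+ m) +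
  (((k == i)%:R * q + (l == i)%:R * p) * theta 0 i * (z ^+ m * d m) +
   theta 0 i ^+ 2 * (p * q) * d m ^+ 2)).
rewrite (_ : (fun n => _) = interleave f g).
  rewrite (cvg_lim _ (cvg_series_interleave (cZ _ _ _ s11)
    (cZ _ _ _ (cD _ _ _ _ (cZ _ _ _ s00) (cD _ _ _ _ (cZ _ _ _ s01) (cZ _ _ _ s11))))))//.
  by rewrite !mulrA; ring.
apply/funext => n; rewrite /walk_sens /interleave /walk_source /f /g /d -/z -/p -/q.
by case: (odd n); ring.
Qed.

Lemma rev_ord_neq i : (rev_ord i == i) = false.
Proof. by case: i => -[|[|]]. Qed.

Lemma ord2P i k : k = i \/ k = rev_ord i.
Proof.
by case: i => -[|[|//]] ?; case: k => -[|[|//]] ?;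
  (left; exact/val_inj) || (right; exact/val_inj).
Qed.

Lemma sum_ord2 (F : 'I_2 -> R) i : \sum_k F k = F i + F (rev_ord i).
Proof.
rewrite (bigD1 i)//= (bigD1 (rev_ord i)) ?rev_ord_neq//= big_pred0 ?addr0// => k.
by have [->|->] := ord2P i k; rewrite eqxx ?andbF.
Qed.

Lemma tr_invmx2 (N : 'M[R]_2) i (i' := rev_ord i)
    (delta := N i i * N i' i' - N i i' * N i' i) :
  delta != 0 -> \tr (invmx N) = (N i i + N i' i') / delta.
Proof.
move=> delta0.
pose M : 'M[R]_2 := \matrix_(k, l)
  ((if k == l then N (rev_ord k) (rev_ord k) else - N k l) / delta).
have NM : N *m M = 1%:M.
  have e1 := rev_ord_neq i; have e2 : (i == rev_ord i) = false by rewrite eq_sym.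
  apply/matrixP => k l; rewrite mxE (sum_ord2 _ i) !mxE.
  have [->|->] := ord2P i k; have [->|->] := ord2P i l;
    rewrite ?rev_ordK ?eqxx ?e1 ?e2 -/i' /=.
  - by rewrite -[RHS](divff delta0) /delta; ring.
  - by ring.
  - by ring.
  - by rewrite -[RHS](divff delta0) /delta; ring.
rewrite -[invmx N]mulmx1 -NM mulKmx; last by case/mulmx1_unit: NM.
by rewrite /mxtrace (sum_ord2 _ i) !mxE !eqxx rev_ordK -mulrDl addrC.
Qed.

Lemma full_pattern : [set node1; node2]%SET = [set: 'I_2]%SET.
Proof. by apply/setP => -[[|[|//]] ?]; rewrite !inE. Qed.

Lemma rev_node1 : rev_ord node1 = node2. Proof. exact/val_inj. Qed.
Lemma rev_node2 : rev_ord node2 = node1. Proof. exact/val_inj. Qed.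

Section Patterns.
Variables (sigma2 lambda : R) (theta : 'rV[R]_2) (t : int).
Hypothesis sigma2_ge0 : 0 <= sigma2.
Hypothesis stable : `|loop_gain theta| < 1.

Lemma information_mx_one_output (B C : {set 'I_2}) i
    (E : experiment B C (fun=> sigma2) (fun=> lambda)) k l :
  B = [set: 'I_2]%SET -> C = [set i]%SET ->
  information_mx E theta t k l =
  sigma2 / lambda * (same_node_info theta k l + other_node_info theta i k l).
Proof.
move=> B_ C_; rewrite information_mxE// C_ big_set1 series_walk_sens// B_ !inE /=.
by ring.
Qed.

(** Node [i] receives the excitation of [rev_ord i] along the odd walks, and
    [rev_ord i] receives its own along the even walks. Together this is what the
    measurement of [i] alone yields when both nodes are excited. *)
Lemma information_mx_one_input (B C : {set 'I_2}) i
    (E : experiment B C (fun=> sigma2) (fun=> lambda)) k l :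
  B = [set rev_ord i]%SET -> C = [set: 'I_2]%SET ->
  information_mx E theta t k l =
  sigma2 / lambda * (same_node_info theta k l + other_node_info theta i k l).
Proof.
move=> B_ C_; rewrite information_mxE// C_ (eq_bigl xpredT) => [|j]; last by rewrite inE.
rewrite (sum_ord2 _ i).
rewrite !series_walk_sens// B_ !inE rev_ordK eqxx.
rewrite [i == _]eq_sym rev_ord_neq.
by rewrite /=; ring.
Qed.

End Patterns.

(** With [u = A B], the determinant of [N] is
    [c^2 A (1 + u + A) / (1 - u)^4]: its numerator over the denominator
    [(1 - u)^6] of the products of entries has the factor [(1 - u)^2]. *)
Lemma tr_inv_information (N : 'M[R]_2) theta (c : R) i :
    c != 0 -> theta 0 i != 0 -> `|loop_gain theta| < 1 ->
    (forall k l, N k l = c * (same_node_info theta k l + other_node_info theta i k l)) ->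
  let A := theta 0 i ^+ 2 in let B := theta 0 (rev_ord i) ^+ 2 in
  \tr (invmx N) = (1 - (A * B) ^+ 2) / c * ((1 + A + B + A ^+ 2) / (A * (1 + A * B + A))).
Proof.
move=> c0 a0 z1 NE A B.
have e1 := rev_ord_neq i.
have zE := loop_gainE theta i; set z := loop_gain theta in z1 zE *.
have z2 : 1 - z ^+ 2 != 0.
  rewrite gt_eqF// subr_gt0 -real_normK ?num_real//.
  by rewrite exprn_ilt1// normr_ge0.
have {}NE k l : N k l = c * (same_node_info theta k l + other_node_info theta i k l).
  exact: NE.
set a := theta 0 i in a0 A zE *; set b := theta 0 (rev_ord i) in B zE *.
have ABE : A * B = z ^+ 2 by rewrite zE exprMn.
have N11 : N i i = c * ((1 + B) * (1 + z ^+ 2) / (1 - z ^+ 2) ^+ 3).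
  rewrite NE /other_node_info /same_node_info eqxx -/z -/a -/b /B /=.
  move: z2; rewrite zE => z2; by field.
have N22 : N (rev_ord i) (rev_ord i) = c * (A * (1 + A) * (1 + z ^+ 2) / (1 - z ^+ 2) ^+ 3).
  rewrite NE /other_node_info /same_node_info rev_ordK e1 -/z -/a -/b /A /=.
  by field.
have N12 : N i (rev_ord i) = c * (z * (1 + z ^+ 2 + 2 * A) / (1 - z ^+ 2) ^+ 3).
  rewrite NE /other_node_info /same_node_info rev_ordK eqxx e1 -/z -/a -/b /A /=.
  move: z2; rewrite zE => z2; by field.
have N21 : N (rev_ord i) i = c * (z * (1 + z ^+ 2 + 2 * A) / (1 - z ^+ 2) ^+ 3).
  rewrite NE /other_node_info /same_node_info rev_ordK eqxx e1 -/z -/a -/b /A /=.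
  move: z2; rewrite zE => z2; by field.
have A0 : 0 < A by rewrite /A exprn_even_gt0.
have B0 : 0 <= B by exact: sqr_ge0.
have w0 : 1 + A * B + A != 0.
  by rewrite gt_eqF// addr_gt0// ltr_wpDr// mulr_ge0// ltW.
have detE : N i i * N (rev_ord i) (rev_ord i) - N i (rev_ord i) * N (rev_ord i) i =
    c ^+ 2 * (A * (1 + A * B + A) / (1 - A * B) ^+ 4).
  rewrite N11 N22 N12 N21.
  rewrite (_ : _ - _ = c ^+ 2 * (A * (1 + A) * (1 + B) * (1 + z ^+ 2) ^+ 2 -
     z ^+ 2 * (1 + z ^+ 2 + 2 * A) ^+ 2) / (1 - z ^+ 2) ^+ 6); last by field.
  by rewrite -ABE; rewrite -ABE in z2; field.
rewrite (tr_invmx2 (i := i)) detE.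
  by rewrite N11 N22 -ABE; rewrite -ABE in z2; field; rewrite c0 w0 z2 gt_eqF.
apply: mulf_neq0; first exact: expf_neq0.
apply: mulf_neq0; first by rewrite mulf_neq0// gt_eqF.
by rewrite invr_neq0// expf_neq0// ABE.
Qed.

(** After clearing denominators, the difference of the two sides is [B - A] times
    a polynomial that is a sum of positive terms when [A B < 1]. *)
Lemma trace_ratio_lt (A B : R) : 0 < A -> A < B -> A * B < 1 ->
  (1 + B + A + B ^+ 2) / (B * (1 + B * A + B)) <
  (1 + A + B + A ^+ 2) / (A * (1 + A * B + A)).
Proof.
move=> A0 AB AB1.
have B0 : 0 < B by exact: lt_trans AB.
have AB0 : 0 < A * B by exact: mulr_gt0.
rewrite ltr_pdivrMr ?mulr_gt0 ?addr_gt0 ?mulr_gt0//.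
rewrite mulrAC ltr_pdivlMr ?mulr_gt0 ?addr_gt0 ?mulr_gt0//.
rewrite -subr_gt0 (_ : _ - _ = (B - A) *
  ((1 - A * B) * (1 + A * B) + (A + B) * (A + B + 2 + A * B))); last by ring.
rewrite mulr_gt0 ?subr_gt0// addr_gt0// mulr_gt0 ?subr_gt0//; first exact: addr_gt0.
  by rewrite !addr_gt0.
by rewrite !addr_gt0.
Qed.

End ClosedForm.

Theorem mainTheorem2 (R : realType) (a12 a21 sigma2 lambda : R)
    (a12_neq0 : a12 != 0) (a21_neq0 : a21 != 0)
    (stable : `|a12 * a21| < 1)
    (sigma2_gt0 : 0 < sigma2) (lambda_gt0 : 0 < lambda)
    (EI : experiment [set node1; node2]%SET [set node1]%SET
            (fun=> sigma2) (fun=> lambda))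
    (EII : experiment [set node1; node2]%SET [set node2]%SET
            (fun=> sigma2) (fun=> lambda))
    (EIII : experiment [set node1]%SET [set node1; node2]%SET
            (fun=> sigma2) (fun=> lambda))
    (EIV : experiment [set node2]%SET [set node1; node2]%SET
            (fun=> sigma2) (fun=> lambda))
    (t : int) :
  let theta0 := cycle_param a12 a21 in
  let PI := asymptotic_cov EI theta0 t in
  let PII := asymptotic_cov EII theta0 t in
  let PIII := asymptotic_cov EIII theta0 t in
  let PIV := asymptotic_cov EIV theta0 t in
  [/\ PI = PIV /\ PII = PIII,
      `|a12| < `|a21| -> \tr PII < \tr PI &
      `|a21| < `|a12| -> \tr PI < \tr PII].
Proof.
move=> theta0 PI PII PIII PIV.
have th1 : theta0 0 node1 = a12 by rewrite mxE.
have th2 : theta0 0 node2 = a21 by rewrite mxE.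
have z1 : `|loop_gain theta0| < 1.
  by rewrite (loop_gainE _ node1) rev_node1 th1 th2.
have s0 := ltW sigma2_gt0; have c0 : sigma2 / lambda != 0.
  by rewrite gt_eqF// divr_gt0.
have fullP := full_pattern.
have IE k l := information_mx_one_output t s0 z1 EI k l fullP erefl.
have IIE k l := information_mx_one_output t s0 z1 EII k l fullP erefl.
have IIIE k l := information_mx_one_input t s0 z1 (i := node2) EIII k l
  (congr1 _ (esym rev_node2)) fullP.
have IVE k l := information_mx_one_input t s0 z1 (i := node1) EIV k l
  (congr1 _ (esym rev_node1)) fullP.
have trI := tr_inv_information c0 _ z1 IE.
have trII := tr_inv_information c0 _ z1 IIE.
rewrite rev_node1 th1 th2 in trI; rewrite rev_node2 th1 th2 in trII.
have A0 : 0 < a12 ^+ 2 by rewrite exprn_even_gt0.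
have B0 : 0 < a21 ^+ 2 by rewrite exprn_even_gt0.
have AB1 : a12 ^+ 2 * a21 ^+ 2 < 1.
  by rewrite -exprMn -real_normK ?num_real// exprn_ilt1.
have K0 : 0 < (1 - (a12 ^+ 2 * a21 ^+ 2) ^+ 2) / (sigma2 / lambda).
  by rewrite !divr_gt0// subr_gt0 exprn_ilt1// mulr_ge0// ltW.
have sqr_lt (x y : R) : `|x| < `|y| -> x ^+ 2 < y ^+ 2.
  by move=> xy; rewrite -(real_normK (num_real x)) -(real_normK (num_real y))
     ltr_pXn2r// nnegrE.
split.
- by split; congr invmx; apply/matrixP => k l; rewrite ?IE ?IVE ?IIE ?IIIE.
- move=> /sqr_lt AB; rewrite /PI /PII trI// trII// [a21 ^+ 2 * a12 ^+ 2]mulrC.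
  by rewrite ltr_pM2l//; have := trace_ratio_lt A0 AB AB1; rewrite [a21 ^+ 2 * a12 ^+ 2]mulrC.
- move=> /sqr_lt BA; rewrite /PI /PII trI// trII// [a21 ^+ 2 * a12 ^+ 2]mulrC.
  rewrite mulrC in AB1.
  by rewrite ltr_pM2l//; have := trace_ratio_lt B0 BA AB1; rewrite [a21 ^+ 2 * a12 ^+ 2]mulrC.
Qed.
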